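(* Let $\triangle abc$ be a kinematic triangle and let $d,e$ be events such that (i) there is a path $de$ (that is, $d\ne e$ and some path, denoted $de$, contains both $d$ and $e$), and (ii) $[b\;c\;d]$ and $[c\;e\;a]$. Then the path $de$ meets the path $ab$ in an event $f$ such that $[a\;f\;b]$.
   Context: Let $\mathcal E$ be a set, whose elements are called events; let $\mathcal P$ be a set of subsets of $\mathcal E$, whose elements are called paths; and let $[\,\cdot\;\cdot\;\cdot\,]$ be a ternary relation (betweenness) on $\mathcal E$. A finite chain is a sequence $(q_0,\dots,q_n)$ of events, $n\ge1$, such that: if $n=1$, then $q_0\ne q_1$ and some path contains both; if $n\ge2$, then $[q_i\;q_j\;q_k]$ for all $0\le i<j<k\le n$. The following axioms are assumed. (I1) $\mathcal E\neq\emptyset$. (I2) For distinct events $a,b$ there are paths $R\ni a$, $S\ni b$ with $R\cap S\ne\emptyset$. (I3) For any two distinct events there is at most one path containing both. (O1) If $[a\;b\;c]$ then some path contains $a,b,c$. (O2) $[a\;b\;c]\Rightarrow[c\;b\;a]$. (O3) $[a\;b\;c]\Rightarrow a\neq c$. (O4) $[a\;b\;c]$ and $[b\;c\;d]$ imply $[a\;b\;d]$ (no distinctness of $a,d$ is assumed). (O5) If $a,b,c$ are distinct events of one path, then $[a\;b\;c]$ or $[b\;c\;a]$ or $[c\;a\;b]$. (O6) If $Q,R,S$ are distinct paths, $T$ is a path, $a\in Q\cap R$, $b\in Q\cap S$, $c\in R\cap S$, and there are $d\in S$ with $[b\;c\;d]$ and $e\in R$ with $[c\;e\;a]$ and $d,e\in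 T$, then there is $f\in T\cap Q$ belonging to a finite chain with first event $a$ and last event $b$, where $a,f,b$ are distinct. Notation: for distinct events $a,b$ lying on a common path, $ab$ denotes that path (unique by (I3)). A kinematic triangle $\triangle abc$ is a set of three distinct events $\{a,b,c\}$ such that each pair of these events belongs to one of three distinct paths (so the paths $ab,bc,ac$ exist and are distinct). *)

(* Defs.v *)
From mathcomp Require Import all_boot.
From mathcomp Require Import classical_sets.

Set Implicit Arguments.
Unset Strict Implicit.
Unset Printing Implicit Defensive.

Local Open Scope classical_set_scope.

(* The set of events is the carrier type [E], [P] is the set of paths, and     *)
(* [B a b c] is the betweenness relation [a b c].                              *)

Definition distinct3 (X : Type) (x y z : X) : Prop :=
  [/\ x <> y, y <> z & x <> z].

Definition finite_chain (E : Type) (P : set (set E)) (B : E -> E -> E -> Prop)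
    (n : nat) (q : 'I_n.+1 -> E) : Prop :=
  [/\ 1 <= n,
      n = 1 -> q ord0 <> q ord_max /\
        exists Q : set E, [/\ P Q, Q (q ord0) & Q (q ord_max)]
    & 2 <= n -> forall i j k : 'I_n.+1, i < j -> j < k -> B (q i) (q j) (q k)].

Record ordered_event_space (E : Type) (P : set (set E))
    (B : E -> E -> E -> Prop) : Prop := OrderedEventSpace {
  axI1 : [set: E] !=set0;
  axI2 : forall a b : E, a <> b ->
    exists R S : set E, [/\ P R, P S, R a, S b & R `&` S !=set0];
  axI3 : forall a b : E, a <> b -> forall Q R : set E,
    P Q -> P R -> Q a -> Q b -> R a -> R b -> Q = R;
  axO1 : forall a b c : E, B a b c ->
    exists Q : set E, [/\ P Q, Q a, Q b & Q c];
  axO2 : forall a b c : E, B a b c -> B c b a;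
  axO3 : forall a b c : E, B a b c -> a <> c;
  axO4 : forall a b c d : E, B a b c -> B b c d -> B a b d;
  axO5 : forall (Q : set E) (a b c : E),
    P Q -> Q a -> Q b -> Q c -> distinct3 a b c ->
    [\/ B a b c, B b c a | B c a b];
  axO6 : forall (Q R S T : set E) (a b c : E),
    P Q -> P R -> P S -> distinct3 Q R S -> P T ->
    (Q `&` R) a -> (Q `&` S) b -> (R `&` S) c ->
    (exists d e : E, [/\ S d, B b c d, R e, B c e a & T d /\ T e]) ->
    exists f : E, (T `&` Q) f /\ distinct3 a f b /\
      exists (n : nat) (q : 'I_n.+1 -> E),
        [/\ finite_chain P B q, q ord0 = a, q ord_max = b
          & exists k : 'I_n.+1, q k = f]
}.

(* [Q] is the path ab; at most one such [Q] exists, by [axI3]. *)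
Definition path_through (E : Type) (P : set (set E)) (a b : E) (Q : set E)
    : Prop :=
  [/\ a <> b, P Q, Q a & Q b].

Definition kinematic_triangle (E : Type) (P : set (set E)) (a b c : E) : Prop :=
  distinct3 a b c /\
  exists Q R S : set E,
    [/\ path_through P a b Q, path_through P a c R, path_through P b c S
      & distinct3 Q R S].

(* Main.v *)
(* The path of [b c d] is bc and that of [c e a] is ac, so axiom O6 applies to *)
(* the path de and yields f on ab in a finite chain from a to b.  As f differs *)
(* from both ends of the chain, it is an interior event of it, hence lies      *)
(* between a and b.                                                            *)
Require Import Defs.
From mathcomp Require Import all_boot.
From mathcomp Require Import classical_sets.
Local Open Scope classical_set_scope.

(** By O1 and uniqueness of paths (I3), [d] lies on bc and [e] on ac, so O6 applies to the path de.
    O6 only places [f] in a chain from [a] to [b]; [finite_chain_between] turns this into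
    betweenness because [f] is neither end. *)

Lemma finite_chain_between (E : Type) (P : set (set E))
    (B : E -> E -> E -> Prop) (n : nat) (q : 'I_n.+1 -> E) (k : 'I_n.+1) :
  finite_chain P B q -> distinct3 (q ord0) (q k) (q ord_max) ->
  B (q ord0) (q k) (q ord_max).
Proof.
move=> [_ _ chain] [q0k qkn _].
have k_gt0 : 0 < k.
  by rewrite lt0n; apply/eqP => k0; apply: q0k; congr q; apply: val_inj.
have k_ltn : k < n.
  rewrite ltn_neqAle -ltnS ltn_ord andbT.
  by apply/eqP => kn; apply: qkn; congr q; apply: val_inj.
(* An index strictly between [0] and [n] forces [2 <= n], which excludes the two-event chain, where
   no betweenness is available. *)
by apply: chain => //; apply: leq_ltn_trans k_gt0 k_ltn.
Qed.

Lemma path_through_unique (E : Type) (P : set (set E))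
    (B : E -> E -> E -> Prop) (a b : E) (Q R : set E) :
  ordered_event_space P B -> path_through P a b Q -> path_through P a b R ->
  Q = R.
Proof. by move=> hE [ab PQ Qa Qb] [_ PR Ra Rb]; apply: (axI3 hE ab). Qed.

Theorem theorem3 (E : Type) (P : set (set E)) (B : E -> E -> E -> Prop)
    (hE : ordered_event_space P B)
    (a b c d e : E) (habc : kinematic_triangle P a b c)
    (hde : exists T : set E, path_through P d e T)
    (hbcd : B b c d) (hcea : B c e a) :
  exists T Q : set E,
    [/\ path_through P d e T, path_through P a b Q
      & exists f : E, (T `&` Q) f /\ B a f b].
Proof.
case: habc => _ [Q [R [S [abQ acR bcS QRS]]]]; case: hde => T deT.
exists T, Q; split=> //.
have [[_ PQ Qa Qb] [ac PR Ra Rc] [bc PS Sb Sc] [_ PT Td Te]] :=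
  And4 abQ acR bcS deT.
have Sd : S d.
  have [S' [PS' S'b S'c S'd]] := axO1 hE hbcd.
  by have -> : S = S' by apply: path_through_unique hE bcS _.
have Re : R e.
  have [R' [PR' R'c R'e R'a]] := axO1 hE hcea.
  by have -> : R = R' by apply: path_through_unique hE acR _.
have [|f [TQf [afb [n [q [chain q0 qn [k qk]]]]]]] :=
  axO6 hE PQ PR PS QRS PT (conj Qa Ra) (conj Qb Sb) (conj Rc Sc).
  by exists d, e.
exists f; split=> //; move: afb; rewrite -q0 -qn -qk.
exact: finite_chain_between chain.
Qed.
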